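(* Let $\mathcal{C}\subseteq\mathbb{R}^n$ be nonempty, compact and convex, let $F:\mathcal{C}\to\mathbb{R}^n$ be $C^1$ and $\mu$-strongly monotone for some $\mu>0$, and let $\{x_k\}_{k\ge 0}$ be a sequence generated by the Frank-Wolfe iteration $$x_{k+1}=x_k+\gamma_{k+1}(s_k-x_k),\qquad s_k\in\operatorname{argmin}_{s\in\mathcal{C}}\langle F(x_k),s\rangle,\qquad x_0\in\mathcal{C},$$ with step sizes $\gamma_k\in(0,1]$ $(k\ge 1)$ satisfying $\gamma_k\to 0$ and $\sum_{k=1}^\infty\gamma_k=\infty$. Let $x^*$ be the unique element of $\mathcal{S}=\{x\in\mathcal{C}:\langle F(x),z-x\rangle\ge 0\ \ \forall z\in\mathcal{C}\}$. Then $x_k\to x^*$ as $k\to\infty$.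
   Context: $\|\cdot\|$ is the Euclidean norm and $\langle\cdot,\cdot\rangle$ the Euclidean inner product on $\mathbb{R}^n$. $F$ is $\mu$-strongly monotone if $\langle F(x)-F(y),x-y\rangle\ge\mu\|x-y\|^2$ for all $x,y\in\mathcal{C}$. At each step $s_k$ is an arbitrary element of the (possibly non-singleton) argmin set. Under these hypotheses $\mathcal{S}$ is a singleton. *)

(* Defs.v *)
From HB Require Import structures.
From mathcomp Require Import all_boot all_order all_algebra.
From mathcomp Require Import all_classical all_reals all_analysis.
Set Implicit Arguments.
Unset Strict Implicit.
Unset Printing Implicit Defensive.
Import Order.TTheory GRing.Theory Num.Theory.
Import numFieldNormedType.Exports.
Local Open Scope classical_set_scope.
Local Open Scope ring_scope.

Definition dotp (R : realType) (n : nat) (u v : 'rV[R]_n) : R :=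
  \sum_(i < n) u 0 i * v 0 i.

(* The library's norm on ['rV[R]_n] is the sup norm, which induces the same
   topology; [enorm] is the Euclidean norm. *)
Definition enorm (R : realType) (n : nat) (u : 'rV[R]_n) : R :=
  Num.sqrt (dotp u u).

(* A map on an arbitrary subset [C] of R^n is of class C^1 when it extends to a
   C^1 map on an open neighborhood of [C] (which may have empty interior); the
   values of [F] outside [C] are irrelevant. *)
Definition C1_on (R : realType) (n : nat) (C : set 'rV[R]_n)
    (F : 'rV[R]_n -> 'rV[R]_n) : Prop :=
  exists (U : set 'rV[R]_n) (G : 'rV[R]_n -> 'rV[R]_n),
    [/\ open U, C `<=` U, (forall x, C x -> G x = F x),
        (forall x, U x -> differentiable G x) &
        (forall x, U x -> {for x, continuous (jacobian G)})].

Definition strongly_monotone (R : realType) (n : nat) (C : set 'rV[R]_n)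
    (mu : R) (F : 'rV[R]_n -> 'rV[R]_n) : Prop :=
  forall x y, C x -> C y ->
    mu * enorm (x - y) ^+ 2 <= dotp (F x - F y) (x - y).

Definition argmin (R : realType) (T : Type) (C : set T) (f : T -> R) : set T :=
  [set s | C s /\ forall z, C z -> f s <= f z].

Definition frank_wolfe (R : realType) (n : nat) (C : set 'rV[R]_n)
    (F : 'rV[R]_n -> 'rV[R]_n) (gamma : nat -> R) (x : nat -> 'rV[R]_n) : Prop :=
  C (x 0%N) /\
  forall k, exists2 s, argmin C (dotp (F (x k))) s &
    x k.+1 = x k + gamma k.+1 *: (s - x k).

Definition VI_solutions (R : realType) (n : nat) (C : set 'rV[R]_n)
    (F : 'rV[R]_n -> 'rV[R]_n) : set 'rV[R]_n :=
  [set x | C x /\ forall z, C z -> 0 <= dotp (F x) (z - x)].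

(* Main.v *)
Require Import Defs.
From HB Require Import structures.
From mathcomp Require Import all_boot all_order all_algebra.
From mathcomp Require Import all_classical all_reals all_analysis.
From mathcomp Require Import ring lra.
Set Implicit Arguments.
Unset Strict Implicit.
Unset Printing Implicit Defensive.
Import Order.TTheory GRing.Theory Num.Theory.
Import numFieldNormedType.Exports.
Local Open Scope classical_set_scope.
Local Open Scope ring_scope.

(** The quantity that drives the proof is the gap
    [g(x) = max_(z in C) <F x, x - z>], attained at the Frank-Wolfe vertex: it
    is nonnegative, and it vanishes exactly at the solutions of the variational
    inequality.  Let [L] be the limsup of [g (x_k)].  Once [L <= 0] is known,
    strong monotonicity concludes:
    [mu |x_k - x*|^2 <= <F x_k, x_k - x*> <= g (x_k)], and [x*] exists since any
    limit point of the run at which [g] tends to [L] has gap at most zero.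

    In continuous time, along [x' = s - x], one has formally
    [g' = - g - <DF(x) (s - x), s - x> <= - g].  The discrete sequence does not
    obey this step by step, because the vertex [s_k] jumps: the correction
    [<F x_(k+1) - F x_k, s_k - s_(k+1)>] has the same order as the decrease, and
    the jumps need not become rare.  What saves the argument is that [g] is a
    maximum, so the kinks of [g] along a curve are convex, and a maximum of
    [g] along the curve is never a convex kink.  It is therefore enough to look
    at a point [p] where [g] takes its largest asymptotic value [L], and only
    backward in time:

    - [maximal_gap_point] yields [p] as a limit point of the run with [g p = L].
    - Going back from an iterate near [p] over a window of elapsed time [T], the
      displacement is [T] times an average of the directions [s_i - x_i].
      These average to some [sigma - p] with [sigma] in [C] almost minimizing
      [<F p, .>], the error tending to zero with [T] ([backward_window]).
    - Letting [T] tend to zero, compactness gives an exact minimizer [sigma]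
      such that [sigma - p] is tangent to backward chords [p - a], where [a] is
      an iterate, so that [g a <= L + o(T)] ([backward_tangent]).
    - Testing the gap at [a] against this same [sigma] gives
      [<F a, a - sigma> <= g a <= L + o(T) = <F p, p - sigma> + o(T)].
      With [p - a = T (sigma - p) + o(T)], monotonicity removes
      [<F p - F a, sigma - p>], which is nonnegative up to [o(T)], and what
      remains is [T L <= o(T)] ([backward_chord_gap_le0]). *)

(** * The Euclidean inner product against the sup norm *)

Lemma dotpC (R : realType) n (u v : 'rV[R]_n) : dotp u v = dotp v u.
Proof. by apply: eq_bigr => i _; rewrite mulrC. Qed.

Lemma dotpDl (R : realType) n (u v w : 'rV[R]_n) :
  dotp (u + v) w = dotp u w + dotp v w.
Proof. by rewrite -big_split; apply: eq_bigr => i _; rewrite mxE mulrDl. Qed.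

Lemma dotpZl (R : realType) n (a : R) (u v : 'rV[R]_n) :
  dotp (a *: u) v = a * dotp u v.
Proof.
by rewrite /dotp mulr_sumr; apply: eq_bigr => i _; rewrite mxE mulrA.
Qed.

Lemma dotpDr (R : realType) n (u v w : 'rV[R]_n) :
  dotp w (u + v) = dotp w u + dotp w v.
Proof. by rewrite dotpC dotpDl !(dotpC w). Qed.

Lemma dotpZr (R : realType) n (a : R) (u v : 'rV[R]_n) :
  dotp u (a *: v) = a * dotp u v.
Proof. by rewrite dotpC dotpZl dotpC. Qed.

Lemma dotpBl (R : realType) n (u v w : 'rV[R]_n) :
  dotp (u - v) w = dotp u w - dotp v w.
Proof. by rewrite -scaleN1r dotpDl dotpZl mulN1r. Qed.

Lemma dotpBr (R : realType) n (u v w : 'rV[R]_n) :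
  dotp w (u - v) = dotp w u - dotp w v.
Proof. by rewrite dotpC dotpBl !(dotpC w). Qed.

Lemma normr_coord_le (R : realType) n (u : 'rV[R]_n) i : `|u 0 i| <= `|u|.
Proof.
rewrite [leRHS]/Num.norm /= mx_normrE; apply/bigmax_geP; right => /=.
by exists (0, i).
Qed.

(** Cauchy-Schwarz for the sup norm, at the price of the factor [n]; only the
    order of magnitude matters below. *)
Lemma normr_dotp_le (R : realType) n (u v : 'rV[R]_n) :
  `|dotp u v| <= n%:R * (`|u| * `|v|).
Proof.
have -> : n%:R * (`|u| * `|v|) = \sum_(i < n) `|u| * `|v|.
  by rewrite sumr_const card_ord mulr_natl.
apply: le_trans (ler_norm_sum _ _ _) (ler_sum _ _) => i _.
by rewrite normrM ler_pM// normr_coord_le.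
Qed.

Lemma sqr_normr_le_dotp (R : realType) n (u : 'rV[R]_n) :
  `|u| ^+ 2 <= dotp u u.
Proof.
have [u0|/mx_norm_neq0[[a i] ui]] := eqVneq (mx_norm u) 0.
  rewrite [`|u|]u0 expr0n/=.
  by apply: sumr_ge0 => i _; rewrite -expr2 sqr_ge0.
rewrite [`|u|]ui /= ord1 real_normK ?num_real// expr2.
rewrite [leRHS](bigD1 i) //= lerDl.
by apply: sumr_ge0 => j _; rewrite -expr2 sqr_ge0.
Qed.

Lemma enorm_sqr (R : realType) n (u : 'rV[R]_n) : enorm u ^+ 2 = dotp u u.
Proof. by rewrite sqr_sqrtr// (le_trans _ (sqr_normr_le_dotp u))// sqr_ge0. Qed.

Lemma cvg_dotp (R : realType) n (T : Type) (A : set_system T)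
    (FA : Filter A) (f g : T -> 'rV[R]_n) (a b : 'rV[R]_n) :
  f t @[t --> A] --> a -> g t @[t --> A] --> b ->
  dotp (f t) (g t) @[t --> A] --> dotp a b.
Proof.
move=> fa gb.
have coord (h : T -> 'rV[R]_n) (c : 'rV[R]_n) i :
    h t @[t --> A] --> c -> h t 0 i @[t --> A] --> c 0 i.
  move=> hc; apply: (cvg_comp h (fun M : 'rV[R]_n => M 0 i) hc).
  exact: coord_continuous.
rewrite /dotp; apply: cvg_big => [|i _]; first exact: add_continuous.
by apply: cvgM; apply: coord.
Qed.

(** * Tools from analysis and convexity *)

Lemma differentiable_lipschitz_at (R : realType) (V W : normedModType R)
    (f : V -> W) (p : V) : differentiable f p ->
  exists2 k, 0 < k & \forall y \near p, `|f y - f p| <= k * `|y - p|.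
Proof.
move=> df; have [k k0 kP] := linear_lipschitz (diff_continuous df).
have /eqaddoP/(_ 1 ltr01) small := diff_locally df.
exists (k + 1); first by rewrite addr_gt0.
apply/nbhs0P; near=> h; rewrite [p + h]addrC addrK.
have : `|(f \o shift p - (cst (f p) + 'd f p)) h| <= 1 * `|h| by near: h.
rewrite mul1r !fctE /= opprD addrA => fh.
rewrite -[_ - f p](subrK ('d f p h)) (le_trans (ler_normD _ _))//.
by rewrite mulrDl mul1r [leRHS]addrC lerD.
Unshelve. all: by end_near. Qed.

(** Ultrafilters replace the extraction of subsequences: all the sequences
    at hand converge simultaneously along one of them. *)
Lemma ultra_compact_cvg (T : Type) (V : topologicalType) (U : set_system T)
    (UU : UltraFilter U) (K : set V) (f : T -> V) :
  compact K -> (\forall t \near U, K (f t)) ->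
  exists2 p, K p & f t @[t --> U] --> p.
Proof.
move=> cK Kf; have [p [Kp pf]] := cK (f @ U) _ Kf.
exists p => // B pB.
have [//|Bf] := in_ultra_setVsetC (f @^-1` B) UU.
by have [y [nBy By]] := pf (~` B) B Bf pB.
Qed.

Lemma convex_weighted_sum (R : realType) (V : lmodType R)
    (K : set (convex_lmodType V)) (w : nat -> R) (v : nat -> V) (j k : nat) :
  convex_set K -> (j < k)%N ->
  (forall i, (j <= i < k)%N -> 0 < w i) ->
  (forall i, (j <= i < k)%N -> K (v i)) ->
  exists2 c : V, K c &
    \sum_(j <= i < k) w i *: v i = (\sum_(j <= i < k) w i) *: c.
Proof.
move=> Kconv; elim: k => // k IH; rewrite ltnS leq_eqVlt.
case/predU1P => [->|jk] w0 Kv.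
  by exists (v k); [apply: Kv; rewrite leqnn ltnSn | rewrite !big_nat1].
have [i ijk|i ijk|c Kc sumc] := IH jk.
- by apply: w0; case/andP: ijk => -> /ltnW.
- by apply: Kv; case/andP: ijk => -> /ltnW.
have jk' := ltnW jk.
rewrite !big_nat_recr//= sumc; set W := \sum_(j <= i < k) w i.
have W0 : 0 <= W.
  rewrite /W big_nat; apply: sumr_ge0 => i /andP[ji ik].
  by rewrite ltW// w0// ji ltnW.
have wk : 0 < w k by rewrite w0// jk' ltnSn.
have Ww : 0 < W + w k by rewrite ltr_wpDl.
(* [W] is the weight already merged into [c]. *)
have t0 : 0 <= W / (W + w k) by rewrite divr_ge0// ltW.
have t1 : W / (W + w k) <= 1 by rewrite ler_pdivrMr// mul1r lerDl ltW.
have Kvk : K (v k) by apply: Kv; rewrite jk' ltnSn.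
exists ((W / (W + w k)) *: c + (1 - W / (W + w k)) *: v k).
  have := Kconv c (v k) (@Itv01 R _ t0 t1).
  by rewrite !inE; exact.
rewrite scalerDr !scalerA mulrBr mulr1 !(mulrC (W + w k)) divfK ?gt_eqF//.
by rewrite [W + w k]addrC addrK.
Qed.

(** * Elapsed time *)

(** The time that the interpolated trajectory spends between iterates [j] and
    [k]: the step from iterate [i] to iterate [i.+1] lasts [gamma i.+1]. *)
Definition elapsed (R : realType) (gamma : nat -> R) (j k : nat) : R :=
  \sum_(j <= i < k) gamma i.+1.

Lemma elapsed_unbounded (R : realType) (gamma : nat -> R) (N : nat) (M : R) :
  (forall k, (1 <= k)%N -> 0 <= gamma k) ->
  (\sum_(1 <= k <oo) (gamma k)%:E = +oo)%E ->
  \forall k \near \oo, M <= elapsed gamma N k.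
Proof.
move=> g0 gsum; have [k Mk] : exists k, M <= elapsed gamma N k.
  apply: contrapT => /forallNP small.
  suff : (\sum_(1 <= k <oo) (gamma k)%:E <= (elapsed gamma 0 N + M)%:E)%E.
    by rewrite gsum leye_eq.
  apply: lime_le.
    by apply: is_cvg_nneseries => i i1 _; rewrite lee_fin g0.
  exists N.+1 => // n /= Nn; rewrite sumEFin lee_fin.
  case: n Nn => // n Nn; rewrite big_add1 /= (big_cat_nat (n := N))//=.
  by rewrite lerD2l; have /negP := small n; rewrite -ltNge => /ltW.
exists (maxn N k) => // l /= kl; apply: le_trans Mk _.
have [kN|Nk] := leqP k N.
  rewrite {1}/elapsed big_geq//.
  by apply: sumr_ge0 => i _; exact: g0.
have kl' : (k <= l)%N by rewrite (leq_trans _ kl)// leq_maxr.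
rewrite /elapsed [leRHS](big_cat_nat (n := k)) ?(ltnW Nk)//= lerDl.
by apply: sumr_ge0 => i _; exact: g0.
Qed.

(** Take for [j] the last index at elapsed time at least [tau] before [k]: it
    overshoots [tau] by less than one step, and late steps are shorter than
    [tau]. *)
Lemma exists_window (R : realType) (gamma : nat -> R) (N : nat) (tau : R) :
  (forall k, (1 <= k)%N -> 0 <= gamma k) ->
  gamma k @[k --> \oo] --> 0 ->
  (\sum_(1 <= k <oo) (gamma k)%:E = +oo)%E -> 0 < tau ->
  \forall k \near \oo, exists2 j, (N <= j < k)%N &
    tau <= elapsed gamma j k <= 2 * tau.
Proof.
move=> g0 gcvg gsum tau0.
have [N1 _ gN1] : \forall k \near \oo, gamma k <= tau.
  by have /cvgr_le := gcvg; apply.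
have := elapsed_unbounded (maxn N N1) tau g0 gsum.
apply: filterS => k tauk.
have [|j|j tauj jmax] := @ex_maxnP (fun j => tau <= elapsed gamma j k) k.
- by exists (maxn N N1).
- move=> tauj; rewrite leqNgt; apply/negP => kj; move: tauj.
  by rewrite /elapsed big_geq ?(ltnW kj)// leNgt tau0.
have Nj := jmax _ tauk.
have jk : (j < k)%N.
  rewrite ltnNge; apply/negP => kj; move: tauj.
  by rewrite /elapsed big_geq// leNgt tau0.
exists j; first by rewrite jk andbT (leq_trans _ Nj)// leq_maxl.
rewrite tauj /= /elapsed big_ltn// mulr_natl mulr2n lerD//.
  by apply: gN1; rewrite /= (leq_trans _ (leqW Nj))// leq_maxr.
by rewrite leNgt; apply/negP => /ltW /jmax; rewrite ltnn.
Qed.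

(** * Average directions of a run *)

(** A trajectory together with the vertices it selected. *)
Definition frank_wolfe_run (R : realType) (n : nat) (C : set 'rV[R]_n)
    (F : 'rV[R]_n -> 'rV[R]_n) (gamma : nat -> R) (x s : nat -> 'rV[R]_n) :=
  [/\ forall k, C (x k), forall k, argmin C (dotp (F (x k))) (s k) &
      forall k, x k.+1 = x k + gamma k.+1 *: (s k - x k)].

Lemma frank_wolfe_run_exists (R : realType) (n : nat) (C : set 'rV[R]_n)
    (F : 'rV[R]_n -> 'rV[R]_n) (gamma : nat -> R) (x : nat -> 'rV[R]_n) :
  convex_set C -> (forall k, (1 <= k)%N -> 0 < gamma k <= 1) ->
  frank_wolfe C F gamma x -> exists s, frank_wolfe_run C F gamma x s.
Proof.
move=> Cconv g01 [Cx0 /(_ _)/cid2 step].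
exists (fun k => s2val (step k)); split=> [k|k|k]; last 2 first.
- exact: (s2valP (step k)).
- exact: (s2valP' (step k)).
elim: k => // k Cxk; have [s [Cs _] ->] := step k.
have /andP[gk0 gk1] := g01 k.+1 isT.
have -> : x k + gamma k.+1 *: (s - x k) =
    gamma k.+1 *: s + (1 - gamma k.+1) *: x k.
  by rewrite scalerBr scalerBl scale1r addrCA.
have := Cconv s (x k) (@Itv01 R _ (ltW gk0) gk1).
by rewrite !inE; exact.
Qed.

Lemma run_displacement (R : realType) (n : nat) (C : set 'rV[R]_n)
    (F : 'rV[R]_n -> 'rV[R]_n) (gamma : nat -> R) (x s : nat -> 'rV[R]_n) j k :
  frank_wolfe_run C F gamma x s -> (j <= k)%N ->
  x k - x j = \sum_(j <= i < k) gamma i.+1 *: (s i - x i).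
Proof.
move=> [_ _ step] jk; rewrite -telescope_sumr//.
by apply: eq_bigr => i _; rewrite step addrC addKr.
Qed.

Lemma run_speed (R : realType) (n : nat) (C : set 'rV[R]_n)
    (F : 'rV[R]_n -> 'rV[R]_n) (gamma : nat -> R) (x s : nat -> 'rV[R]_n)
    (D : R) j k :
  (forall i, (1 <= i)%N -> 0 <= gamma i) -> (forall u, C u -> `|u| <= D) ->
  frank_wolfe_run C F gamma x s -> (j <= k)%N ->
  `|x k - x j| <= 2 * D * elapsed gamma j k.
Proof.
move=> g0 CD run jk; rewrite (run_displacement run)//; case: run => Cx Cs _.
apply: le_trans (ler_norm_sum _ _ _) _.
rewrite mulrC /elapsed mulr_suml; apply: ler_sum => i _.
rewrite normrZ ger0_norm ?g0// ler_wpM2l ?g0//.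
apply: le_trans (ler_normB _ _) _.
rewrite mulr_natl mulr2n lerD ?CD//.
by case: (Cs i).
Qed.

(** The pairs of conditions imposed on the directions [v = s i - x i], namely
    to be close to [sigma - p] for an [eps]-minimizer [sigma] of [c], define a
    convex set of [v]; hence they pass to the average direction over a window,
    although the vertices [s i] may vary wildly inside the window. *)
Lemma window_mean_direction (R : realType) (n : nat) (C : set 'rV[R]_n)
    (F : 'rV[R]_n -> 'rV[R]_n) (gamma : nat -> R) (x s : nat -> 'rV[R]_n)
    (c p : 'rV[R]_n) (eps : R) j k :
  convex_set C -> (forall i, (1 <= i)%N -> 0 < gamma i) ->
  frank_wolfe_run C F gamma x s -> (j < k)%N ->
  (forall i, (j <= i < k)%N -> `|x i - p| <= eps) ->
  (forall i, (j <= i < k)%N -> forall z, C z -> dotp c (s i - z) <= eps) ->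
  exists sigma, [/\ C sigma, forall z, C z -> dotp c (sigma - z) <= eps &
    `|x k - x j - elapsed gamma j k *: (sigma - p)| <= elapsed gamma j k * eps].
Proof.
move=> Cconv g0 run jk xp sopt.
have [Cx Cs _] := run.
pose K := [set v : convex_lmodType 'rV[R]_n |
  exists sigma, [/\ C sigma, forall z, C z -> dotp c (sigma - z) <= eps &
    `|v - (sigma - p)| <= eps]].
have Kconv : convex_set K.
  move=> u v t; rewrite !inE => -[a [Ca aopt ua]] [b [Cb bopt vb]].
  have t0 : 0 <= t%:num by [].
  have t1 : 0 <= 1 - t%:num by rewrite subr_ge0.
  have epsE : eps = t%:num * eps + (1 - t%:num) * eps by ring.
  exists (t%:num *: a + (1 - t%:num) *: b); split.
  - by have := Cconv a b t; rewrite !inE; exact.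
  - move=> z Cz.
    have -> : t%:num *: a + (1 - t%:num) *: b - z =
        t%:num *: (a - z) + (1 - t%:num) *: (b - z).
      rewrite !scalerBr addrACA -opprD -[in RHS]scalerDl.
      by rewrite [_ + (1 - _)]addrC subrK scale1r.
    by rewrite dotpDr !dotpZr [leRHS]epsE lerD// ler_wpM2l ?aopt ?bopt.
  - have -> : t%:num *: u + (1 - t%:num) *: v -
        (t%:num *: a + (1 - t%:num) *: b - p) =
        t%:num *: (u - (a - p)) + (1 - t%:num) *: (v - (b - p)).
      apply/rowP => i; rewrite !mxE; ring.
    rewrite (le_trans (ler_normD _ _))// !normrZ !ger0_norm//.
    by rewrite [leRHS]epsE lerD// ler_wpM2l.
have [i|i ijk|v [sigma [Csigma sopt' vsigma]] sumv] :=
  @convex_weighted_sum R 'rV[R]_n K (fun i => gamma i.+1)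
    (fun i => s i - x i) j k Kconv jk.
- by rewrite g0.
- exists (s i); split; first by case: (Cs i).
  + exact: sopt.
  + have -> : s i - x i - (s i - p) = - (x i - p).
      by apply/rowP => l; rewrite !mxE; ring.
    by rewrite normrN xp.
exists sigma; split => //.
have e0 : 0 <= elapsed gamma j k by apply: sumr_ge0 => i _; rewrite ltW// g0.
rewrite (run_displacement run (ltnW jk)) sumv -/(elapsed _ _ _) -scalerBr.
by rewrite normrZ ger0_norm// ler_wpM2l.
Qed.

(** * A limit point of largest gap *)

(** The two halves of the definition of the limsup, in the form in which they
    are consumed: an eventual upper bound and a frequent lower bound. *)
Lemma bounded_limsup (R : realType) (u : nat -> R) (M : R) :
  (forall k, `|u k| <= M) ->
  exists L, (forall e, 0 < e -> \forall k \near \oo, u k <= L + e) /\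
    (forall e N, 0 < e -> exists2 k, (N <= k)%N & L - e <= u k).
Proof.
move=> uM; pose B := [set b | \forall k \near \oo, u k <= b].
have BM : B M by apply: nearW => k; rewrite (le_trans (ler_norm _)).
have Blb : lbound B (- M).
  move=> b [N _ Nb]; apply: le_trans (Nb N (leqnn N)).
  by rewrite lerNl (le_trans (ler_norm _))// normrN.
have Binf : has_inf B by split; [exists M | exists (- M)].
exists (inf B); split=> [e e0|e N e0].
  have [b Bb /ltW be] := inf_adherent e0 Binf.
  by apply: filterS Bb => k /le_trans; apply.
apply: contrapT => noN.
have : inf B <= inf B - e.
  apply: ge_inf; first by exists (- M).
  exists N => // k /= Nk; rewrite leNgt; apply/negP => /ltW eu.
  by apply: noN; exists k.
by rewrite leNgt ltrBlDr ltrDl e0.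
Qed.

(** Follow the run along indices where the gap tends to its limsup, and let [p]
    and [sbar] be limits of the iterates and of their vertices.  By continuity
    of [F] the vertex [sbar] is optimal at [p], so that the limsup of the gap is
    [<F p, p - sbar>], the gap of [p]. *)
Lemma maximal_gap_point (R : realType) (n : nat) (C : set 'rV[R]_n)
    (F : 'rV[R]_n -> 'rV[R]_n) (gamma : nat -> R) (x s : nat -> 'rV[R]_n) :
  compact C -> (forall u, C u -> {for u, continuous F}) ->
  frank_wolfe_run C F gamma x s ->
  exists p sbar,
    [/\ C p, C sbar,
        (forall z, C z -> dotp (F p) (sbar - z) <= 0),
        (forall e, 0 < e -> \forall k \near \oo,
          dotp (F (x k)) (x k - s k) <= dotp (F p) (p - sbar) + e) &
        forall e N, 0 < e -> exists2 k, (N <= k)%N & `|x k - p| <= e].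
Proof.
move=> cC Fcont [Cx Cs _].
have Cs' k : C (s k) by case: (Cs k).
pose gap k := dotp (F (x k)) (x k - s k).
have Fcv U (FU : Filter U) (f : nat -> 'rV[R]_n) u : C u ->
    f i @[i --> U] --> u -> F (f i) @[i --> U] --> F u.
  by move=> Cu fu; apply: continuous_cvg => //; exact: Fcont.
have [M gapM] : exists M, forall k, `|gap k| <= M.
  have [D [_ CD]] := compact_bounded cC.
  have cFC : compact (F @` C).
    apply: continuous_compact => //; apply/continuous_in_subspaceT => u.
    by rewrite inE => Cu; exact: Fcont.
  have [E [_ FE]] := compact_bounded cFC.
  exists (n%:R * ((E + 1) * (2 * (D + 1)))) => k.
  apply: le_trans (normr_dotp_le _ _) _; rewrite ler_wpM2l// ler_pM//.
    by apply: FE; [rewrite ltrDl | exists (x k)].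
  rewrite (le_trans (ler_normB _ _))// mulr_natl mulr2n.
  by rewrite lerD// CD// ltrDl.
have [L [gapL Lgap]] := bounded_limsup gapM.
have /choice[kappa kappaP] m :
    exists k, (m <= k)%N /\ L - m.+1%:R^-1 <= gap k.
  have [|k mk gk] := Lgap m.+1%:R^-1 m; first by rewrite invr_gt0.
  by exists k.
(* An ultrafilter on the positions [m] of the subsequence [kappa]. *)
have [U [UU ooU]] := ultraFilterLemma (F := \oo : set_system nat) _.
have [p Cp xp] := @ultra_compact_cvg _ _ U UU C (x \o kappa) cC
  (nearW _ (fun m => Cx (kappa m))).
have [sbar Csbar ssbar] := @ultra_compact_cvg _ _ U UU C (s \o kappa) cC
  (nearW _ (fun m => Cs' (kappa m))).
have Fxp : F (x (kappa m)) @[m --> U] --> F p by exact: (Fcv _ _ _ _ Cp xp).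
have gapp : gap (kappa m) @[m --> U] --> dotp (F p) (p - sbar).
  by apply: cvg_dotp => //; exact: cvgB.
have Lp : L <= dotp (F p) (p - sbar).
  have cvgL : L - harmonic m @[m --> U] --> L.
    rewrite -[X in _ --> X]subr0; apply: cvgB; first exact: cvg_cst.
    by apply: (cvg_trans _ cvg_harmonic); exact: cvg_app.
  apply: (ler_cvg_to cvgL gapp).
  by apply: nearW => m; case: (kappaP m).
exists p, sbar; split=> // [z Cz|e e0|e N e0].
- have optU : dotp (F (x (kappa m))) (s (kappa m) - z) @[m --> U] -->
      dotp (F p) (sbar - z).
    by apply: cvg_dotp => //; apply: cvgB => //; exact: cvg_cst.
  apply: (ler_cvg_to optU (cvg_cst 0)).
  apply: nearW => m; rewrite dotpBr subr_le0.
  by case: (Cs (kappa m)) => _; exact.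
- apply: filterS (gapL e e0) => k /le_trans; apply.
  by rewrite lerD2r.
- have xpe : \forall m \near U, `|p - x (kappa m)| <= e.
    by have /cvgrPdist_le := xp; exact.
  have Nk : \forall m \near U, (N <= kappa m)%N.
    apply: ooU; exists N => // m /= Nm.
    by rewrite (leq_trans Nm)//; case: (kappaP m).
  have [m [pm Nm]] := filter_ex (filterI xpe Nk).
  by exists (kappa m) => //; rewrite distrC.
Qed.

(** * Backward chords at a point of largest gap *)

Lemma elapsed_le (R : realType) (gamma : nat -> R) (j i k : nat) :
  (forall k, (1 <= k)%N -> 0 < gamma k) -> (j <= i <= k)%N ->
  elapsed gamma i k <= elapsed gamma j k.
Proof.
move=> g0 /andP[ji ik]; rewrite /elapsed [leRHS](big_cat_nat (n := i))//= lerDr.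
by apply: sumr_ge0 => l _; rewrite ltW// g0.
Qed.

(** A chord [p - a], run through in time [T], with slope [sigma - p] up to
    [eps], from a point [a] whose gap exceeds [L] by at most [T * eps].  Both
    errors are measured relative to [T], since the chord is eventually divided
    by [T]. *)
Definition backward_chord (R : realType) (n : nat) (C : set 'rV[R]_n)
    (F : 'rV[R]_n -> 'rV[R]_n) (L : R) (p sigma : 'rV[R]_n) (eps : R) :=
  exists T a, [/\ 0 < T <= eps, C a, `|p - a - T *: (sigma - p)| <= T * eps &
    forall z, C z -> dotp (F a) (a - z) <= L + T * eps].

(** Fix the length of the window first, short enough for [F] to be almost
    constant along it.  Then choose the final iterate so late that its distance
    to [p], and the excess of the gap over [L] at the other end of the window,
    are small compared with that length.  A vertex [s i] of the window minimizes
    [<F (x i), .>] exactly, hence [<F p, .>] almost. *)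
Lemma backward_window (R : realType) (n : nat) (C : set 'rV[R]_n)
    (F : 'rV[R]_n -> 'rV[R]_n) (gamma : nat -> R) (x s : nat -> 'rV[R]_n)
    (D L : R) (p : 'rV[R]_n) :
  convex_set C -> 0 < D -> (forall u, C u -> `|u| <= D) ->
  (forall k, (1 <= k)%N -> 0 < gamma k) -> gamma k @[k --> \oo] --> 0 ->
  (\sum_(1 <= k <oo) (gamma k)%:E = +oo)%E ->
  frank_wolfe_run C F gamma x s -> {for p, continuous F} ->
  (forall e, 0 < e -> \forall k \near \oo,
    dotp (F (x k)) (x k - s k) <= L + e) ->
  (forall e N, 0 < e -> exists2 k, (N <= k)%N & `|x k - p| <= e) ->
  forall eps, 0 < eps ->
  exists sigma, [/\ C sigma, (forall z, C z -> dotp (F p) (sigma - z) <= eps) &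
    backward_chord C F L p sigma eps].
Proof.
move=> Cconv D0 CD g0 gcvg gsum run Fp gapL pfreq eps eps0.
have [Cx Cs _] := run.
have g0' k : (1 <= k)%N -> 0 <= gamma k by move=> /g0/ltW.
pose e1 := eps / 2; have e10 : 0 < e1 by rewrite divr_gt0.
(* [K * (e1 / K)] dominates the error on [<F p, s i - z>] when [F (x i)] is
   replaced by [F p]: vectors [s i - z] have norm at most [2 * D]. *)
pose K := n%:R * (2 * D) + 1; have K0 : 0 < K.
  by rewrite ltr_wpDl// !mulr_ge0// ltW.
have /nbhs_ballP[delta /= delta0 Fdelta] :
    nbhs p (fun u => `|F p - F u| <= e1 / K).
  by have /cvgrPdist_le := Fp; apply; rewrite divr_gt0.
pose rho := Num.min (delta / 2) e1.
have rho0 : 0 < rho by rewrite lt_min e10 divr_gt0.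
have rhod : rho < delta.
  by rewrite gt_min [X in X || _](_ : _ = true)// ltr_pdivrMr// ltr_pMr// ltr1n.
have rhoe : rho <= e1 by rewrite ge_min lexx orbT.
(* A window lasts at most [2 * tau] and the speed is at most [2 * D], so the
   run moves by at most [rho / 2] during the window. *)
pose tau := Num.min e1 (rho / (8 * D)).
have tau0 : 0 < tau by rewrite lt_min e10 divr_gt0// mulr_gt0.
have taue : 2 * tau <= eps.
  by rewrite mulrC -ler_pdivlMr// ge_min lexx.
have taurho : 2 * D * (2 * tau) <= rho / 2.
  have : tau <= rho / (8 * D) by rewrite ge_min lexx orbT.
  rewrite ler_pdivlMr ?mulr_gt0// => h; lra.
have [N _ gapN] := gapL (tau * eps) (mulr_gt0 tau0 eps0).
have [N1 _ winN] := exists_window N g0' gcvg gsum tau0.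
have [k N1k xkp] : exists2 k, (N1 <= k)%N &
    `|x k - p| <= Num.min (rho / 2) (tau * e1).
  by apply: pfreq; rewrite lt_min divr_gt0//= mulr_gt0.
move: xkp; rewrite le_min => /andP[xkrho xktau].
have [j /andP[Nj jk] /andP[tauT T2tau]] := winN k N1k.
set T := elapsed gamma j k in tauT T2tau *.
have T0 : 0 < T by apply: lt_le_trans tauT.
have xi i : (j <= i < k)%N -> `|x i - p| <= rho.
  move=> /andP[ji ik].
  have jik : (j <= i <= k)%N by rewrite ji ltnW.
  have xki : `|x k - x i| <= rho / 2.
    rewrite (le_trans (run_speed g0' CD run (ltnW ik)))//.
    rewrite (le_trans _ taurho)// ler_wpM2l ?mulr_ge0 ?(ltW D0)//.
    by rewrite (le_trans (elapsed_le g0 jik)).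
  rewrite -[x i - p](subrKA (x k)) (le_trans (ler_normD _ _))//.
  by rewrite distrC [leRHS]splitr lerD.
have [i ijk|i ijk z Cz|sigma [Csigma sopt disp]] :=
  @window_mean_direction R n C F gamma x s (F p) p e1 j k Cconv g0 run jk.
- by rewrite (le_trans (xi i ijk)).
- have [Csi siopt] := Cs i.
  rewrite -[F p](subrK (F (x i))) dotpDl -[leRHS]addr0 lerD//; last first.
    by rewrite dotpBr subr_le0 siopt.
  rewrite (le_trans (ler_norm _))// (le_trans (normr_dotp_le _ _))//.
  have FF : `|F p - F (x i)| <= e1 / K.
    apply: Fdelta; rewrite -ball_normE /= distrC.
    by rewrite (le_lt_trans (xi i ijk)).
  have sz : `|s i - z| <= 2 * D.
    by rewrite (le_trans (ler_normB _ _))// mulr_natl mulr2n lerD// CD.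
  apply: (@le_trans _ _ (n%:R * (e1 / K * (2 * D)))).
    by rewrite ler_wpM2l// ler_pM.
  rewrite mulrCA mulrAC ler_pdivrMr// ler_wpM2l ?(ltW e10)//.
  by rewrite /K lerDl.
exists sigma; split=> // [z Cz|].
  by rewrite (le_trans (sopt z Cz))// ler_pdivrMr// ler_pMr// ler1n.
exists T, (x j); split=> // [||z Cz].
- by rewrite T0 (le_trans T2tau).
- have -> : p - x j - T *: (sigma - p) =
      - (x k - p) + (x k - x j - T *: (sigma - p)).
    by apply/rowP => l; rewrite !mxE; ring.
  rewrite (le_trans (ler_normD _ _))// normrN.
  have -> : T * eps = T * e1 + T * e1 by rewrite /e1; lra.
  by rewrite lerD// (le_trans xktau)// ler_wpM2r// ltW.
- apply: (@le_trans _ _ (dotp (F (x j)) (x j - s j))).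
    rewrite !dotpBr lerD2l lerN2; by case: (Cs j) => _; exact.
  by rewrite (le_trans (gapN j Nj))// lerD2l ler_wpM2r// ltW.
Qed.

(** The direction of [backward_window] depends on [eps] and is only almost
    optimal; the optimality defect is of the order of the length of the chord,
    the same order as the gap decrease sought.  A limit direction as [eps] tends
    to zero is exactly optimal, and still is the slope of arbitrarily short
    chords. *)
Lemma backward_tangent (R : realType) (n : nat) (C : set 'rV[R]_n)
    (F : 'rV[R]_n -> 'rV[R]_n) (L : R) (p : 'rV[R]_n) :
  compact C ->
  (forall eps, 0 < eps -> exists sigma, [/\ C sigma,
    (forall z, C z -> dotp (F p) (sigma - z) <= eps) &
    backward_chord C F L p sigma eps]) ->
  exists sigma, [/\ C sigma, (forall z, C z -> dotp (F p) (sigma - z) <= 0) &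
    forall eps, 0 < eps -> backward_chord C F L p sigma eps].
Proof.
move=> cC approx.
have /choice[sig sigP] m : exists sigma, [/\ C sigma,
    (forall z, C z -> dotp (F p) (sigma - z) <= harmonic m) &
    backward_chord C F L p sigma (harmonic m)].
  by apply: approx; rewrite /harmonic invr_gt0.
have [U [UU ooU]] := ultraFilterLemma (F := \oo : set_system nat) _.
have Csig m : C (sig m) by case: (sigP m).
have [sigma Csigma sigU] := ultra_compact_cvg UU cC (nearW _ Csig).
have harmU : harmonic m @[m --> U] --> (0 : R).
  by apply: (cvg_trans _ cvg_harmonic); exact: cvg_app.
exists sigma; split=> // [z Cz|eps eps0].
- have optU : dotp (F p) (sig m - z) @[m --> U] --> dotp (F p) (sigma - z).
    by apply: cvg_dotp; [exact: cvg_cst | apply: cvgB => //; exact: cvg_cst].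
  apply: (ler_cvg_to optU harmU); apply: nearW => m.
  by case: (sigP m) => _ + _; exact.
- have e2 : 0 < eps / 2 by rewrite divr_gt0.
  have close : \forall m \near U, `|sigma - sig m| <= eps / 2.
    by have /cvgrPdist_le := sigU; exact.
  have small : \forall m \near U, harmonic m <= eps / 2.
    by have /cvgr_le := harmU; exact.
  have [m [smm hm]] := filter_ex (filterI close small).
  have [_ _ [T [a [/andP[T0 Th] Ca disp gapa]]]] := sigP m.
  have he : harmonic m <= eps.
    by rewrite (le_trans hm)// ler_pdivrMr// ler_pMr// ler1n.
  exists T, a; split=> // [||z Cz]; first by rewrite T0 (le_trans Th).
    have -> : p - a - T *: (sigma - p) =
        (p - a - T *: (sig m - p)) - T *: (sigma - sig m).
      by apply/rowP => l; rewrite !mxE; ring.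
    rewrite (le_trans (ler_normB _ _))// normrZ gtr0_norm//.
    have -> : T * eps = T * (eps / 2) + T * (eps / 2) by lra.
    by rewrite lerD ?ler_pM2l// (le_trans disp)// ler_pM2l.
  by rewrite (le_trans (gapa z Cz))// lerD2l ler_pM2l.
Qed.

(** * The limit gap vanishes *)

(** Write [p - a = T (sigma - p) + e].  As [sigma] is optimal at [p] and
    admissible at [a], the chord property gives
    [0 <= <F p, p - sigma> - <F a, a - sigma> + T eps], which equals
    [<F p - F a, p - sigma> + <F a, p - a> + T eps].  Monotonicity bounds the
    first term by [<F p - F a, e> / T], of order [T eps] because [F] is
    Lipschitz at [p], and the second one by
    [<F p, p - a> = - T <F p, p - sigma> + <F p, e>].  Dividing by [T],
    [<F p, p - sigma>] is at most a multiple of [eps]. *)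
Lemma backward_chord_gap_le0 (R : realType) (n : nat) (C : set 'rV[R]_n)
    (F : 'rV[R]_n -> 'rV[R]_n) (p sbar sigma : 'rV[R]_n) :
  (forall u v, C u -> C v -> 0 <= dotp (F u - F v) (u - v)) ->
  differentiable F p -> C p -> C sbar -> C sigma ->
  (forall z, C z -> dotp (F p) (sigma - z) <= 0) ->
  (forall eps, 0 < eps ->
    backward_chord C F (dotp (F p) (p - sbar)) p sigma eps) ->
  dotp (F p) (p - sbar) <= 0.
Proof.
move=> mono dF Cp Csbar Csigma sigmaopt chord.
set L := dotp (F p) (p - sbar).
have [lam lam0 /nbhs_ballP[delta /= delta0 lip]] :=
  differentiable_lipschitz_at dF.
pose A := `|sigma - p| + 1; have A0 : 0 < A by rewrite ltr_wpDl.
pose M := n%:R * (lam * A) + n%:R * `|F p| + 1.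
have M0 : 0 < M by rewrite ltr_wpDl// addr_ge0// !mulr_ge0// ltW.
(* The middle condition on [eps] keeps [a] in the ball where the Lipschitz
   estimate holds. *)
suff bound eps : 0 < eps -> eps <= 1 -> eps * A < delta -> L <= M * eps.
  rewrite leNgt; apply/negP => L0.
  pose eps := Num.min 1 (Num.min (delta / (2 * A)) (L / (2 * M))).
  have eps0 : 0 < eps by rewrite !lt_min ltr01 !divr_gt0 ?mulr_gt0.
  have epsA : eps <= delta / (2 * A) by rewrite !ge_min lexx orbT.
  have epsM : eps <= L / (2 * M) by rewrite !ge_min lexx !orbT.
  rewrite ler_pdivlMr ?mulr_gt0// in epsA.
  rewrite ler_pdivlMr ?mulr_gt0// in epsM.
  have : L <= M * eps by apply: bound; [by []|rewrite !ge_min lexx|lra].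
  lra.
move=> eps0 eps1 epsA.
have [T [a [/andP[T0 Teps] Ca disp gapa]]] := chord eps eps0.
set e := p - a - T *: (sigma - p) in disp.
have pa : p - a = T *: (sigma - p) + e by rewrite /e [RHS]addrC subrK.
have dotp_pa w : dotp w (p - a) = T * dotp w (sigma - p) + dotp w e.
  by rewrite pa [LHS]dotpDr dotpZr.
have pa_le : `|p - a| <= T * A.
  rewrite pa (le_trans (ler_normD _ _))// normrZ gtr0_norm// /A mulrDr mulr1.
  by rewrite lerD2l (le_trans disp)// ler_piMr// ltW.
have FpFa : `|F p - F a| <= lam * (T * A).
  rewrite distrC (le_trans (lip a _))//; last by rewrite distrC ler_pM2l.
  rewrite -ball_normE /= (le_lt_trans pa_le)// (le_lt_trans _ epsA)//.
  by rewrite ler_pM2r.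
have cross : dotp (F p - F a) (p - sigma) <= T * (n%:R * (lam * A) * eps).
  have err : dotp (F p - F a) e <= n%:R * (lam * (T * A) * (T * eps)).
    rewrite (le_trans (ler_norm _))// (le_trans (normr_dotp_le _ _))//.
    by rewrite ler_wpM2l// ler_pM.
  have := mono p a Cp Ca; rewrite dotp_pa => mpa.
  rewrite -(ler_pM2l T0).
  have -> : p - sigma = (-1) *: (sigma - p) by rewrite scaleN1r opprB.
  rewrite dotpZr; lra.
have along : dotp (F a) (p - a) <=
    - (T * dotp (F p) (p - sigma)) + T * (n%:R * `|F p| * eps).
  have err : dotp (F p) e <= n%:R * (`|F p| * (T * eps)).
    rewrite (le_trans (ler_norm _))// (le_trans (normr_dotp_le _ _))//.
    by rewrite ler_wpM2l// ler_wpM2l.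
  have := mono p a Cp Ca; rewrite dotpBl (dotp_pa (F p)) => mpa.
  have -> : p - sigma = (-1) *: (sigma - p) by rewrite scaleN1r opprB.
  rewrite dotpZr; lra.
have Lsigma : L <= dotp (F p) (p - sigma).
  have := sigmaopt sbar Csbar; rewrite /L !dotpBr; lra.
have := gapa sigma Csigma; rewrite -/L => gapsigma.
have split_gap : dotp (F p) (p - sigma) - dotp (F a) (a - sigma) =
    dotp (F p - F a) (p - sigma) + dotp (F a) (p - a).
  by rewrite !(dotpBl, dotpBr); ring.
rewrite (le_trans Lsigma)// -(ler_pM2l T0) /M; lra.
Qed.

(** * Convergence *)

Theorem theorem10 (R : realType) (n : nat) (C : set 'rV[R]_n)
    (F : 'rV[R]_n -> 'rV[R]_n) (mu : R)
    (gamma : nat -> R) (x : nat -> 'rV[R]_n)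
    (C_nonempty : C !=set0) (C_compact : compact C) (C_convex : convex_set C)
    (F_C1 : C1_on C F) (mu_gt0 : 0 < mu) (F_mono : strongly_monotone C mu F)
    (gamma_itv : forall k, (1 <= k)%N -> 0 < gamma k <= 1)
    (gamma_cvg0 : gamma k @[k --> \oo] --> 0)
    (gamma_sum : (\sum_(1 <= k <oo) (gamma k)%:E = +oo)%E)
    (x_FW : frank_wolfe C F gamma x) :
  exists xstar : 'rV[R]_n,
    VI_solutions C F = [set xstar] /\ x k @[k --> \oo] --> xstar.
Proof.
have [s [Cx Cs step]] := frank_wolfe_run_exists C_convex gamma_itv x_FW.
(* From here on [F] is replaced by its extension [G], which agrees with it on
   [C] and is differentiable at the points of [C], whereas the values of [F]
   off [C] are arbitrary. *)
have [U [G [_ CU GF dG _]]] := F_C1.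
have smono u v : C u -> C v -> mu * `|u - v| ^+ 2 <= dotp (G u - G v) (u - v).
  move=> Cu Cv; rewrite !GF//; apply: le_trans (F_mono u v Cu Cv).
  by rewrite ler_pM2l// enorm_sqr sqr_normr_le_dotp.
have mono u v : C u -> C v -> 0 <= dotp (G u - G v) (u - v).
  move=> Cu Cv; rewrite (le_trans _ (smono u v Cu Cv))//.
  by rewrite mulr_ge0// ?sqr_ge0 ?ltW.
have run : frank_wolfe_run C G gamma x s by split=> // k; rewrite GF.
have Gcont u : C u -> {for u, continuous G}.
  by move=> Cu; apply: differentiable_continuous; exact/dG/CU.
have g0 k : (1 <= k)%N -> 0 < gamma k by move=> /gamma_itv/andP[].
have [D D0 CD] : exists2 D, 0 < D & forall u, C u -> `|u| <= D.
  have [D [_ CD]] := compact_bounded C_compact.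
  exists (`|D| + 1) => [|u]; first by rewrite ltr_wpDl.
  by apply: CD; rewrite ltr_pwDr// ler_norm.
have [p [sbar [Cp Csbar sbaropt gapL pfreq]]] :=
  maximal_gap_point C_compact Gcont run.
set L := dotp (G p) (p - sbar) in gapL.
have [sigma [Csigma sigmaopt chord]] := backward_tangent C_compact
  (backward_window C_convex D0 CD g0 gamma_cvg0 gamma_sum run
    (Gcont p Cp) gapL pfreq).
have L0 : L <= 0.
  exact: (backward_chord_gap_le0 mono (dG p (CU p Cp)) Cp Csbar Csigma
    sigmaopt chord).
have pVI z : C z -> 0 <= dotp (G p) (z - p).
  by move=> Cz; have := sbaropt z Cz; move: L0; rewrite /L !dotpBr; lra.
exists p; split.
  apply/seteqP; split=> [q [Cq qVI]|_ ->]; last first.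
    by split=> // z Cz; rewrite -GF//; exact: pVI.
  have := smono q p Cq Cp.
  have := qVI p Cp; have := pVI q Cq; rewrite -!GF// dotpBl => h1 h2 h3.
  have qp : `|q - p| ^+ 2 <= 0.
    rewrite -(ler_pM2l mu_gt0) mulr0 (le_trans h3)//.
    by move: h1 h2; rewrite !dotpBr; lra.
  apply/eqP; rewrite -subr_eq0 -normr_eq0 -sqrf_eq0.
  by rewrite eq_le qp sqr_ge0.
apply/cvgrPdist_le => e e0.
have := gapL (mu * e ^+ 2) (mulr_gt0 mu_gt0 (exprn_gt0 2 e0)).
apply: filterS => k gapk.
rewrite distrC -ler_sqr ?nnegrE ?(ltW e0)// -(ler_pM2l mu_gt0).
apply: le_trans (smono _ _ (Cx k) Cp) _.
have [_ /(_ p Cp)] := Cs k; rewrite -GF// => sk.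
have := pVI (x k) (Cx k); move: gapk L0 sk; rewrite dotpBl !dotpBr; lra.
Qed.
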